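(* Let $s\ge1$ and let $(\mathbf{x}_n)_{n\ge0}$ be a generalized Niederreiter sequence in base $b=q$ with generating polynomials $p_1,\dots,p_s$. Let $e_i=\deg(p_i)$ ($1\le i\le s$), $e_0=e_1+\dots+e_s$, $d=e_0$ and $t=e_0-s$. Then for every integer $m\ge 9(d+t)s^2$, $$1+\min_{0\le Q<b^m}\ \max_{1\le N\le b^m,\ \mathbf{w}\in E_m^s} N\,D^*\big((\mathbf{x}_{n\oplus Q}\oplus\mathbf{w})_{0\le n<N}\big)\ \ge\ b^{-d}\big(4(d+t)s^2\big)^{-s}m^{s},$$ where $E_m=\{[y]_m:y\in[0,1)\}$.
   Context: Generalized Niederreiter sequence: let $q$ be a prime power, $b=q$, $\mathbb{F}_q$ the field with $q$ elements and $\psi:\{0,\dots,b-1\}\to\mathbb{F}_q$ a bijection with $\psi(0)=0$. Let $p_1,\dots,p_s\in\mathbb{F}_q[x]$ be distinct monic irreducible polynomials, $e_i=\deg p_i$. For each $1\le i\le s$ and $j\ge1$ let $y_{i,j,0},\dots,y_{i,j,e_i-1}\in\mathbb{F}_q[x]$ be polynomials whose residues modulo $p_i$ are linearly independent over $\mathbb{F}_q$. Expand $y_{i,j,k}(x)/p_i(x)^j=\sum_r a^{(i)}(j,k,r)x^{-r}$ as a Laurent series in $x^{-1}$. For $j\ge1$ write $j-1=Qe_i+k$ with integers $Q\ge0$, $0\le k<e_i$, and put $c^{(i)}_{j,r}=a^{(i)}(Q+1,k,r)$ for $r\ge1$. For $n=\sum_{r\ge1}n_rb^{r-1}$ ($n_r\in\{0,\dots,b-1\}$),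 the $i$-th coordinate of $\mathbf{x}_n$ is $x_n^{(i)}=\sum_{j\ge1}x^{(i)}_{n,j}b^{-j}$ with digits $x^{(i)}_{n,j}=\psi^{-1}\big(\sum_{r\ge1}c^{(i)}_{j,r}\psi(n_r)\big)$; the operations below act on these digit sequences. Notation: $[x]_m=\sum_{j=1}^m x_jb^{-j}$ for $x=\sum_j x_jb^{-j}$ (other points of $[0,1)$ use the $b$-adic expansion not ending in infinitely many digits $b-1$); so $E_m=\{ab^{-m}:0\le a<b^m\}$. Digital shift: $x\oplus\gamma=\sum_jv_jb^{-j}$ with $v_j\in\{0,\dots,b-1\}$, $v_j\equiv x_j+\gamma_j\pmod b$, applied coordinatewise on $[0,1)^s$. For integers $n,Q\in[0,b^m)$, $n\oplus Q$ is the integer in $[0,b^m)$ whose $m$ base-$b$ digits are the digitwise sums mod $b$ of those of $n$ and $Q$. Discrepancy: for points $(\mathbf{y}_n)_{0\le n<N}$ in $[0,1)^s$ and $\boldsymbol\gamma\in(0,1]^s$, $J_{\boldsymbol\gamma}=\prod_i[0,\gamma_i)$, $\Delta=\#\{0\le n<N:\mathbf{y}_n\in J_{\boldsymbol\gamma}\}-N\gamma_1\cdots\gamma_s$, and $D^*((\mathbf{y}_n)_{0\le n<N})=\sup_{\boldsymbol\gamma\in(0,1]^s}|\Delta|/N$. *)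

(* Defs.v *)
From HB Require Import structures.
From mathcomp Require Import all_boot all_order all_algebra.
From mathcomp Require Import all_classical all_reals all_analysis.
From mathcomp Require Import zify.

Set Implicit Arguments.
Unset Strict Implicit.
Unset Printing Implicit Defensive.

Import Order.TTheory GRing.Theory Num.Theory.
Import numFieldNormedType.Exports.

Local Open Scope classical_set_scope.
Local Open Scope ring_scope.

(* A Laurent series in x^{-1} is a function a : int -> F, where a r is the
   coefficient of x^{-r}, vanishing for all sufficiently negative r. *)

Definition laurent_of_poly (F : fieldType) (f : {poly F}) (r : int) : F :=
  if r <= 0 then f`_(`|r|%N) else 0.

(* [a] is the expansion of f / g: g * a = f, compared coefficientwise. *)
Definition laurent_expansion (F : fieldType) (f g : {poly F})
    (a : int -> F) : Prop :=
  (exists r0 : int, forall r : int, r < r0 -> a r = 0) /\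
  (forall r : int,
     \sum_(i < size g) g`_i * a (r + i%:Z) = laurent_of_poly f r).

Lemma laurent_expansion_exists (F : fieldType) (f g : {poly F}) :
  g != 0 -> exists a, laurent_expansion f g a.
Proof.
move=> g0; pose h (M : nat) : {poly F} := (f * 'X^M) %/ g.
have hS M i : (h M.+1)`_i.+1 = (h M)`_i.
  have e : f * 'X^(M.+1) = h M * 'X * g + (f * 'X^M) %% g * 'X.
    by rewrite exprSr mulrA {1}(divp_eq (f * 'X^M) g) mulrDl mulrAC.
  rewrite {1}/h e divp_addl_mul // coefD coefMX /=.
  rewrite [X in _ + X]nth_default ?addr0 //.
  rewrite size_divp // leq_subLR.
  apply: (leq_trans (size_polyMleq _ _)).
  have := ltn_modpN0 (f * 'X^M) g0; rewrite size_polyX addn2 /=.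
  by move: (size (_ %% _)) (size g) => u v; lia.
have hD M n i : (h (M + n)%N)`_(i + n) = (h M)`_i.
  by elim: n => [|n IH]; rewrite ?addn0 // !addnS hS.
pose a (z : int) : F := match z with Posz n => (h n)`_0 | Negz n => (h 0)`_n.+1 end.
have aE z (M : nat) : z <= M%:Z -> a z = (h M)`_(`|(M%:Z - z)%R|%N).
  case: z => n lzM.
    have lnM : (n <= M)%N by [].
    have -> : `|(M%:Z - n%:Z)%R|%N = (0 + (M - n))%N by lia.
    by rewrite -{1}(subnKC lnM) hD.
  have -> : `|(M%:Z - Negz n)%R|%N = (n.+1 + M)%N by lia.
  by rewrite [X in h X](_ : M = 0 + M)%N ?hD.
exists a; split.
  exists (- (size (h 0%N))%:Z) => r lr.
  rewrite (aE r 0%N); last by lia.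
  rewrite nth_default //; move: lr; move: (size _) => u; lia.
move=> k.
pose sg := size g; pose M := (`|k| + sg)%N.
pose D := `|(M%:Z - k)%R|%N.
have lD : (sg <= D)%N by rewrite /D /M; lia.
have DE (i : nat) : (i < sg)%N -> a (k + i%:Z) = (h M)`_(D - i).
  move=> li; rewrite (aE _ M); last by rewrite /M; lia.
  by congr nth; rewrite /D /M; lia.
rewrite (eq_bigr (fun i : 'I_(size g) => g`_i * (h M)`_(D - i))); last first.
  by move=> i _; rewrite DE // /sg ltn_ord.
have -> : \sum_(i < size g) g`_i * (h M)`_(D - i) = (g * h M)`_D.
  rewrite coefM -(big_mkord xpredT (fun i => g`_i * (h M)`_(D - i))).
  rewrite -(big_mkord xpredT (fun i => g`_i * (h M)`_(D - i))).
  rewrite [RHS](big_cat_nat (n := sg)) //=; last exact: leqW.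
  rewrite [X in _ + X]big_nat_cond [X in _ + X]big1 ?addr0 // => i.
  by rewrite andbT => /andP[li _]; rewrite nth_default // mul0r.
have -> : g * h M = f * 'X^M - (f * 'X^M) %% g.
  by rewrite {1}(divp_eq (f * 'X^M) g) addrK mulrC.
rewrite coefB [X in _ - X]nth_default ?subr0; last first.
  by apply: leq_trans lD; rewrite ltnW // ltn_modpN0.
have eD : D%:Z = M%:Z - k by rewrite /D /M; lia.
rewrite coefMXn /laurent_of_poly.
case: (lerP k 0) => lk; case: ltnP => lD'.
  by exfalso; lia.
- by congr nth; lia.
- by [].
by exfalso; lia.
Qed.

Definition pdeg (F : fieldType) (p : {poly F}) : nat := (size p).-1.

Definition residues_lin_indep (F : fieldType) (p : {poly F}) (e : nat)
    (y : nat -> {poly F}) : Prop :=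
  forall c : 'I_e -> F,
    \sum_(k < e) c k *: (y k %% p) = 0 -> forall k, c k = 0.

(* Digits are numbered from 1: n = \sum_(r >= 1) n_r b^(r-1). *)
Definition nat_digit (b n r : nat) : nat := ((n %/ b ^ r.-1) %% b)%N.

(* n (+) Q on the m base-b digits. *)
Definition nat_shift (b m n Q : nat) : nat :=
  (\sum_(1 <= r < m.+1)
     ((nat_digit b n r + nat_digit b Q r) %% b) * b ^ r.-1)%N.

Lemma field_card_gt0 (F : finFieldType) : (0 < #|F|)%N.
Proof. by apply/card_gt0P; exists 0. Qed.

Definition zero_digit (F : finFieldType) : 'I_#|F| :=
  Ordinal (field_card_gt0 F).

Definition nat_digit_ord (F : finFieldType) (n r : nat) : 'I_#|F| :=
  Ordinal (ltn_pmod (n %/ #|F| ^ r.-1) (field_card_gt0 F)).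

(* c_{j,r} = a(Q+1, k, r) where j - 1 = Q e + k and 0 <= k < e. *)
Definition gen_matrix (F : finFieldType) (e : nat)
    (a : nat -> nat -> int -> F) (j r : nat) : F :=
  a ((j.-1 %/ e).+1)%N (j.-1 %% e)%N r%:Z.

(* The j-th digit (j >= 1) of one coordinate of x_n. The sum over r >= 1 stops
   at r = n, because n_r = 0 for r > n and psi 0 = 0. *)
Definition niederreiter_digit (F : finFieldType) (psi : 'I_#|F| -> F)
    (psiV : F -> 'I_#|F|) (c : nat -> nat -> F) (n j : nat) : nat :=
  psiV (\sum_(1 <= r < n.+1) c j r * psi (nat_digit_ord F n r)).

(* \sum_(j >= 1) v_j b^(-j) *)
Definition badic_value (R : realType) (b : nat) (v : nat -> nat) : R :=
  limn (fun k => \sum_(1 <= j < k.+1) (v j)%:R / b%:R ^+ j : R).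

(* The j-th digit (j >= 1) of y in [0,1), in the b-adic expansion that does not
   end in infinitely many digits b - 1. *)
Definition real_digit (R : realType) (b : nat) (y : R) (j : nat) : nat :=
  (Num.truncn (y * b%:R ^+ j) %% b)%N.

Lemma real_digit_expansion (R : realType) (b : nat) (y : R) :
  (1 < b)%N -> 0 <= y < 1 -> badic_value R b (real_digit b y) = y.
Proof.
move=> b1 /andP[y0 y1].
have b0 : 0 < b%:R :> R by rewrite ltr0n; lia.
have bu k : (b%:R : R) ^+ k != 0 by rewrite expf_neq0 // gt_eqF.
pose t k := Num.truncn (y * b%:R ^+ k).
have ge k : 0 <= y * b%:R ^+ k by rewrite mulr_ge0 // exprn_ge0 // ltW.
have tS k : (t k.+1 %/ b)%N = t k.
  apply/esym/truncn_def.
  have /andP[h1 h2] := truncn_itv (ge k.+1).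
  rewrite -/(t k.+1) in h1 h2.
  have e : y * b%:R ^+ k.+1 = y * b%:R ^+ k * b%:R by rewrite exprSr mulrA.
  apply/andP; split.
    rewrite -(ler_pM2r b0) -e -natrM.
    by apply: le_trans h1; rewrite ler_nat leq_divM.
  rewrite -(ltr_pM2r b0) -e -natrM; apply: lt_le_trans h2 _.
  by rewrite ler_nat -ltn_divLR //; lia.
have part k : \sum_(1 <= j < k.+1) (real_digit b y j)%:R / b%:R ^+ j
    = (t k)%:R / b%:R ^+ k :> R.
  elim: k => [|k IH].
    by rewrite big_geq // /t expr0 mulr1 (@truncn_def _ y 0%N) ?mul0r // y0 y1.
  rewrite big_nat_recr //= IH /real_digit -/(t k.+1).
  rewrite [in RHS](divn_eq (t k.+1) b) natrD natrM mulrDl tS.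
  by congr (_ + _); rewrite exprSr -mulf_div divff ?mulr1 // gt_eqF.
rewrite /badic_value; apply/cvg_lim => //.
rewrite (_ : (fun k => _) = fun k => (t k)%:R / b%:R ^+ k :> R); last first.
  exact/funext.
have cz : (fun k => y - (b%:R^-1 : R) ^+ k) @ \oo --> y.
  rewrite -[X in _ --> X]subr0; apply: cvgB; first exact: cvg_cst.
  apply: cvg_expr; rewrite ger0_norm ?invr_ge0 ?ltW //.
  by rewrite invf_lt1 // ltr1n.
apply: (squeeze_cvgr _ cz (cvg_cst y)); near=> k.
have /andP[h1 h2] := truncn_itv (ge k).
have bk : 0 < b%:R ^+ k :> R by rewrite exprn_gt0.
rewrite ler_pdivrMr // h1 andbT ler_pdivlMr // mulrBl exprVn mulVf // ?bu.
by rewrite lerBlDr natr1 ltW.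
Unshelve. all: end_near.
Qed.

(* [y]_m *)
Definition badic_trunc (R : realType) (b m : nat) (y : R) : R :=
  \sum_(1 <= j < m.+1) (real_digit b y j)%:R / b%:R ^+ j.

Definition Eset (R : realType) (b m : nat) : set R :=
  [set badic_trunc b m y | y in [set y : R | 0 <= y < 1]].

(* x (+) w, where the first point is given by its digit sequence. *)
Definition digital_shift (R : realType) (b : nat) (x : nat -> nat) (w : R) : R :=
  badic_value R b (fun j => (x j + real_digit b w j) %% b)%N.

Definition box_count (R : realType) (s N : nat) (y : nat -> 'I_s -> R)
    (g : 'I_s -> R) : nat :=
  #|[pred n : 'I_N | [forall i, 0 <= y n i < g i]]|.

Definition local_discr (R : realType) (s N : nat) (y : nat -> 'I_s -> R)
    (g : 'I_s -> R) : R :=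
  (box_count N y g)%:R - N%:R * \prod_i g i.

Definition star_discr (R : realType) (s N : nat) (y : nat -> 'I_s -> R) : R :=
  sup [set `|local_discr N y g| / N%:R | g in
        [set g : 'I_s -> R | forall i, 0 < g i <= 1]].

(* max over 1 <= N <= b^m and w in E_m^s of N D*((x_{n (+) Q} (+) w)_{0<=n<N}),
   the digits of the i-th coordinate of x_n being x n i. The set is finite and
   nonempty, so its supremum is its maximum. *)
Definition max_shifted_discr (R : realType) (b m s : nat)
    (x : nat -> 'I_s -> nat -> nat) (Q : nat) : R :=
  sup [set z : R | exists (N : nat) (w : 'I_s -> R),
    [/\ (1 <= N <= b ^ m)%N, (forall i, Eset b m (w i)) &
        z = N%:R * star_discr N
              (fun n i => digital_shift b (x (nat_shift b m n Q) i) (w i))]].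

(* Minimum over the finite nonempty range 0 <= Q < b^m. *)
Definition minmax_shifted_discr (R : realType) (b m s : nat)
    (x : nat -> 'I_s -> nat -> nat) : R :=
  inf [set max_shifted_discr R b m x Q | Q in [set Q : nat | (Q < b ^ m)%N]].

(* Main.v *)
(* The proof uses two properties of the first m digits. If two indices agree
   above their (M+1)-st digit and differ there, and the points agree in the first
   g_i - 1 digits of coordinate i, then \sum_i g_i <= M + d; and a box fixing g_i
   digits of coordinate i contains at most b^(M - \sum_i g_i) of the b^M points
   whose indices share all digits above the M-th, as soon as
   \sum_i g_i + t <= M. Both follow from one fact: the first e_i u_i digits of
   coordinate i, read as a functional of the digit polynomial z of n, vanish only
   if p_i^(u_i) divides z.

   Put A = d + t + 1, let gamma have base-b digit 1 exactly at the places
   A, 2A, ..., kA, let N have top digit b - 1 at these places, and choose the shift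
   w so that the point of index N is gamma in every coordinate. The box
   [0,gamma)^s, with time cut at N, splits into pieces indexed by
   (j_0, j_1, ..., j_s) of relative volume b^(-A (j_0 + ... + j_s)). A piece with
   j_0 + ... + j_s <= k contains at most the expected number of points, and all
   other pieces are empty since their points would be too close to the point of
   index N. At least floor(k/s)^s pieces have sum k + 1, each missing
   b^(-d-1) points for each of b - 1 values of the time digit. Only upper bounds
   on the counts occur, so points whose digits end in b - 1, b - 1, ... and whose
   value is therefore rounded up do no harm. *)

Require Import Defs.
From HB Require Import structures.
From mathcomp Require Import all_boot all_order all_algebra.
From mathcomp Require Import all_classical all_reals all_analysis.
From mathcomp Require Import zify ring lra.

Set Implicit Arguments.
Unset Strict Implicit.
Unset Printing Implicit Defensive.

Import Order.TTheory GRing.Theory Num.Theory.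
Import numFieldNormedType.Exports.

Local Open Scope ring_scope.

(** * Multiplication of Laurent series in x^(-1) by polynomials *)

Definition laurent_mul (F : fieldType) (h : {poly F}) (a : int -> F) (r : int)
    : F := \sum_(i < size h) h`_i * a (r + i%:Z).

Lemma laurent_mul_widen (F : fieldType) (n : nat) (h : {poly F}) a r :
  (size h <= n)%N -> laurent_mul h a r = \sum_(i < n) h`_i * a (r + i%:Z).
Proof.
move=> hn; rewrite /laurent_mul.
rewrite (big_ord_widen n (fun i => h`_i * a (r + i%:Z))) // big_mkcond.
apply: eq_bigr => i _; case: ltnP => // hi.
by rewrite nth_default // mul0r.
Qed.

Lemma laurent_mulDl (F : fieldType) (h1 h2 : {poly F}) a r :
  laurent_mul (h1 + h2) a r = laurent_mul h1 a r + laurent_mul h2 a r.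
Proof.
pose n := maxn (size h1) (size h2).
rewrite !(@laurent_mul_widen _ n) ?leq_maxl ?leq_maxr ?size_polyD //.
by rewrite -big_split /=; apply: eq_bigr => i _; rewrite coefD mulrDl.
Qed.

Lemma laurent_mulMXC (F : fieldType) (h : {poly F}) c a r :
  laurent_mul (h * 'X + c%:P) a r = laurent_mul h a (r + 1) + c * a r.
Proof.
rewrite (@laurent_mul_widen _ (size h).+1) ?size_MXaddC; last first.
  by case: ifP.
rewrite big_ord_recl /= addrC; congr (_ + _).
  rewrite /laurent_mul; apply: eq_bigr => i _.
  rewrite /bump /= add1n coefD coefMX coefC /= addr0; congr (_ * a _); lia.
by rewrite coefD coefMX coefC /= add0r addr0.
Qed.

Lemma laurent_mulM (F : fieldType) (h1 h2 : {poly F}) a r :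
  laurent_mul (h1 * h2) a r = laurent_mul h1 (laurent_mul h2 a) r.
Proof.
elim/poly_ind: h1 h2 r => [|h1 c IH] h2 r.
  by rewrite mul0r /laurent_mul size_poly0 !big_ord0.
rewrite laurent_mulMXC mulrDl laurent_mulDl mulrAC -IH.
rewrite -[X in laurent_mul X]addr0 -[0]/(0%:P) laurent_mulMXC mul0r addr0.
congr (_ + _).
rewrite (@laurent_mul_widen _ (size h2)); last first.
  by rewrite mul_polyC; apply: size_scale_leq.
by rewrite /laurent_mul mulr_sumr; apply: eq_bigr => i _; rewrite coefCM mulrA.
Qed.

Lemma laurent_mulBr (F : fieldType) (h : {poly F}) a1 a2 r :
  laurent_mul h (fun i => a1 i - a2 i) r
  = laurent_mul h a1 r - laurent_mul h a2 r.
Proof. by rewrite -sumrB; apply: eq_bigr => i _; rewrite mulrBr. Qed.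

Lemma laurent_mul_poly (F : fieldType) (h q : {poly F}) r :
  laurent_mul h (laurent_of_poly q) r = laurent_of_poly (h * q) r.
Proof.
elim/poly_ind: h r => [|h c IH] r.
  rewrite mul0r /laurent_mul size_poly0 big_ord0 /laurent_of_poly.
  by case: ifP => //; rewrite coef0.
rewrite laurent_mulMXC IH /laurent_of_poly mulrDl mulrAC coefD coefMX coefCM.
case: (lerP r 0) => r0; last first.
  by rewrite ifF ?mulr0 ?addr0 //; apply/negbTE; lia.
congr (_ + _); case: (eqVneq r 0) => [->|rn]; first by [].
rewrite ifT; last by lia.
rewrite ifF; last by apply/negbTE; lia.
by congr nth; lia.
Qed.

Lemma laurent_expansion_mul (F : fieldType) (f g h : {poly F}) a :
  laurent_expansion f g a -> laurent_expansion (h * f) g (laurent_mul h a).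
Proof.
move=> [[r0 a0] aE]; split.
  exists (r0 - (size h)%:Z) => r hr; rewrite /laurent_mul big1 // => i _.
  by rewrite a0 ?mulr0 //; have := ltn_ord i; lia.
move=> r; rewrite -/(laurent_mul g (laurent_mul h a) r) -laurent_mulM mulrC.
rewrite laurent_mulM -laurent_mul_poly /laurent_mul.
by apply: eq_bigr => i _; congr (_ * _); exact: aE.
Qed.

Lemma laurent_expansion_cancel (F : fieldType) (f g h : {poly F}) a :
  laurent_expansion f (g * h) a -> laurent_expansion f g (laurent_mul h a).
Proof.
move=> [[r0 a0] aE]; split.
  exists (r0 - (size h)%:Z) => r hr; rewrite /laurent_mul big1 // => i _.
  by rewrite a0 ?mulr0 //; have := ltn_ord i; lia.
by move=> r; rewrite -aE -/(laurent_mul g (laurent_mul h a) r) -laurent_mulM.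
Qed.

(** Subtracting the quotient q of [f] by [p] leaves rho / p with deg rho < e = deg p. This series
    starts at x^(-1), and as [p] is monic its first coefficient is the one of x^(e-1) in rho. *)
Lemma laurent_expansion_residue (F : fieldType) (f p : {poly F}) a :
  p \is monic -> (0 < pdeg p)%N -> laurent_expansion f p a ->
  a 1 = (f %% p)`_(pdeg p).-1.
Proof.
move=> pm p0 [[r0 a0] aE].
set e := pdeg p in p0 *; set rho := f %% p.
have pn : p != 0 by apply: monic_neq0.
have se : size p = e.+1 by rewrite /e /pdeg prednK // size_poly_gt0.
have srho : (size rho <= e)%N by rewrite -ltnS -se ltn_modp.
pose q := f %/ p.
pose c i := a i - laurent_of_poly q i.
(* [c] expands rho / p. Solving p * c = rho for the term of the leading coefficient 1 of [p] gives a
   recurrence of order [e]. *)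
have cE r : c (r + e%:Z) = laurent_of_poly rho r
    - \sum_(i < e) p`_i * c (r + i%:Z).
  have: laurent_mul p c r = laurent_of_poly rho r.
    rewrite laurent_mulBr laurent_mul_poly {1}/laurent_mul aE.
    rewrite /laurent_of_poly; case: ifP => _; last by rewrite subr0.
    by rewrite -coefB {1}(divp_eq f p) (mulrC p) addrAC subrr add0r.
  rewrite /laurent_mul se big_ord_recr /= => <-.
  have -> : p`_e = 1 by move/monicP: pm; rewrite lead_coefE se.
  by rewrite mul1r addrAC subrr add0r.
have [r1 c0] : exists r1 : int, forall r, r < r1 -> c r = 0.
  exists (Num.min r0 (- (size q)%:Z)) => r.
  rewrite lt_min => /andP[h1 h2]; rewrite /c a0 // /laurent_of_poly sub0r.
  case: ifP => hr; rewrite ?oppr0 // nth_default ?oppr0 //.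
  move: hr h2; move: (size q) => n; lia.
(* Upward induction from [r1]: up to index 0 the recurrence only meets coefficients of [rho] of
   degree at least [e], which vanish. *)
have cz r : r <= 0 -> c r = 0.
  move=> hr; pose n := `|r - r1|%N.
  case: (ltrP r r1) => [/c0 //|hr1].
  have rn : r = r1 + n%:Z by rewrite /n; lia.
  clearbody n; subst r; clear hr1.
  elim/ltn_ind: n hr => n IH hr.
  have -> : r1 + n%:Z = (r1 + n%:Z - e%:Z) + e%:Z by rewrite subrK.
  rewrite cE /laurent_of_poly ifT; last by lia.
  rewrite nth_default; last by apply: leq_trans srho _; lia.
  rewrite big1 ?subr0 // => i _; have hi := ltn_ord i.
  case: (ltrP (r1 + n%:Z - e%:Z + i%:Z) r1) => h; first by rewrite c0 ?mulr0.
  have -> : r1 + n%:Z - e%:Z + i%:Z = r1 + (n - (e - i))%N%:Z by lia.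
  by rewrite IH ?mulr0 //; lia.
have := cE (1 - e%:Z); rewrite subrK {1}/c /laurent_of_poly /= subr0 => ->.
rewrite ifT; last by lia.
rewrite big1 ?subr0; last first.
  by move=> i _; rewrite cz ?mulr0 //; have := ltn_ord i; lia.
by congr nth; lia.
Qed.

(** * Divisibility by powers of irreducible polynomials *)

Lemma residues_span (F : fieldType) (p : {poly F}) (y : nat -> {poly F})
    (f : {poly F}) :
  p != 0 -> residues_lin_indep p (pdeg p) y -> (size f <= pdeg p)%N ->
  exists c : 'I_(pdeg p) -> F, f = \sum_(k < pdeg p) c k *: (y k %% p).
Proof.
move=> p0 yI sf; set e := pdeg p in yI sf *.
have se : size p = e.+1 by rewrite /e /pdeg prednK // size_poly_gt0.
have sy k : (size (y k %% p)%R <= e)%N by rewrite -ltnS -se ltn_modp.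
pose Y : 'M[F]_e := \matrix_(k < e) poly_rV (y k %% p).
have mulY (v : 'rV_e) : rVpoly (v *m Y) = \sum_(k < e) v 0 k *: (y k %% p).
  rewrite mulmx_sum_row linear_sum /=; apply: eq_bigr => k _.
  by rewrite linearZ /= rowK poly_rV_K.
(* Independence of the residues is triviality of the left kernel; [Y] is square, hence
   invertible. *)
have Yfree : row_free Y.
  apply: inj_row_free => v vY; apply/rowP => k; rewrite mxE.
  by apply: (yI (v 0)); rewrite -mulY vY linear0.
exists ((poly_rV f *m invmx Y) 0).
by rewrite -mulY mulmxKV ?poly_rV_K // -row_free_unit.
Qed.

(** The pairing of z and f given by the coefficient of x^(e-1) in z f mod p is nondegenerate, and
    the residues of the y_k span all possible f. *)
Lemma dvdp_residues (F : fieldType) (p z : {poly F}) (y : nat -> {poly F}) :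
  p \is monic -> (0 < pdeg p)%N -> residues_lin_indep p (pdeg p) y ->
  (forall k, (k < pdeg p)%N -> ((z * y k) %% p)`_(pdeg p).-1 = 0) -> p %| z.
Proof.
move=> pm e0 yI zy; have p0 : p != 0 by apply: monic_neq0.
set e := pdeg p in e0 yI zy *.
have se : size p = e.+1 by rewrite /e /pdeg prednK // size_poly_gt0.
have zf (f : {poly F}) : (size f <= e)%N -> ((z * f) %% p)`_e.-1 = 0.
  move=> sf; have [c ->] := residues_span p0 yI sf.
  rewrite mulr_sumr (big_morph (fun q => q %% p) (@modpD _ p) (mod0p p)).
  rewrite coef_sum big1 // => k _.
  by rewrite -scalerAr modpZl coefZ modp_mul zy ?mulr0.
apply: contraT; rewrite /dvdp => r0; set r := z %% p in r0.
have sr : (size r <= e)%N by rewrite -ltnS -se ltn_modp.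
have sr0 : (0 < size r)%N by rewrite size_poly_gt0.
(* This power of x lifts the leading coefficient of [r] exactly to degree e - 1, so no reduction
   modulo [p] takes place. *)
have := zf 'X^(e - size r); rewrite size_polyXn mulrC -modp_mul -/r.
rewrite modp_small; last first.
  by rewrite se ltnS mulrC size_mulXn // subnK.
rewrite coefXnM ifF; last by apply/negbTE; lia.
have -> : (e.-1 - (e - size r) = (size r).-1)%N by lia.
rewrite -lead_coefE => /(_ _)/eqP; rewrite lead_coef_eq0 (negbTE r0) => h.
by apply: h; lia.
Qed.

(** Induction on [u]: once z = z' p^u, the series z y / p^(u+1) equals z' y / p, whose coefficient
    of x^(-1) is the top coefficient of z' y mod p. Its vanishing for all k gives one more factor
    [p]. *)
Lemma dvdp_exp_laurent (F : fieldType) (p z : {poly F})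
    (y : nat -> nat -> {poly F}) (a : nat -> nat -> int -> F) u :
  p \is monic -> (0 < pdeg p)%N ->
  (forall j, (1 <= j)%N -> residues_lin_indep p (pdeg p) (y j)) ->
  (forall j k, (1 <= j)%N -> (k < pdeg p)%N ->
     laurent_expansion (y j k) (p ^+ j) (a j k)) ->
  (forall j k, (1 <= j <= u)%N -> (k < pdeg p)%N ->
     laurent_mul z (a j k) 1 = 0) ->
  p ^+ u %| z.
Proof.
move=> pm e0 yI aE; elim: u => [|u IH] za; first by rewrite expr0 dvd1p.
have /dvdpP[z' zE] : p ^+ u %| z.
  by apply: IH => j k /andP[j0 ju]; apply: za; rewrite j0 leqW.
rewrite zE exprS dvdp_mul2r ?expf_neq0 ?monic_neq0 //.
apply: (dvdp_residues pm e0 (yI u.+1 isT)) => k ke.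
rewrite -[RHS](za u.+1 k) ?leqnn // zE laurent_mulM.
apply/esym/laurent_expansion_residue => //.
apply: laurent_expansion_mul; apply: laurent_expansion_cancel.
by rewrite -exprS; apply: aE.
Qed.

Lemma coprimep_irreducible (F : fieldType) (p q : {poly F}) :
  irreducible_poly p -> irreducible_poly q -> p \is monic -> q \is monic ->
  p != q -> coprimep p q.
Proof.
move=> pI qI pm qm; apply: contraR => npq.
have gp : gcdp p q %= p.
  by apply: pI.2; rewrite ?dvdp_gcdl.
have gq : gcdp p q %= q.
  by apply: qI.2; rewrite ?dvdp_gcdr.
rewrite -eqp_monic //; rewrite eqp_sym in gp.
exact: eqp_trans gp gq.
Qed.

Lemma dvdp_prod_irreducible (F : fieldType) (s : nat) (p : 'I_s -> {poly F})
    (u : 'I_s -> nat) (z : {poly F}) :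
  (forall i, p i \is monic) -> (forall i, irreducible_poly (p i)) ->
  injective p -> (forall i, p i ^+ u i %| z) -> \prod_i p i ^+ u i %| z.
Proof.
move=> pm pI pinj pz; rewrite -big_enum /=.
elim: (enum _) (enum_uniq 'I_s) => [|i r IH] /=; first by rewrite big_nil dvd1p.
move=> /andP[ir ur]; rewrite big_cons Gauss_dvdp ?pz ?IH //.
rewrite big_seq_cond; apply: (big_ind (fun q => coprimep (p i ^+ u i) q)).
- exact: coprimep1.
- by move=> a b; rewrite coprimepMr => -> ->.
move=> j; rewrite andbT => jr; apply: coprimep_expl; apply: coprimep_expr.
apply: coprimep_irreducible => //; apply: contra ir => /eqP/pinj ->.
exact: jr.
Qed.

Lemma size_prod_monic_exp (F : fieldType) (s : nat) (p : 'I_s -> {poly F})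
    (u : 'I_s -> nat) :
  (forall i, p i \is monic) ->
  size (\prod_i p i ^+ u i) = (\sum_i pdeg (p i) * u i).+1.
Proof.
move=> pm.
suff [] : size (\prod_i p i ^+ u i) = (\sum_i pdeg (p i) * u i).+1 /\
   \prod_i p i ^+ u i \is monic by [].
apply: (big_ind2 (fun (q : {poly F}) n => size q = n.+1 /\ q \is monic)).
- by rewrite size_poly1 monic1.
- move=> q n q' n' [sq qm] [sq' qm']; split; last exact: rpredM.
  by rewrite size_monicM ?monic_neq0 // sq sq' addSn /= addnS.
move=> i _; split; last exact: rpredX.
by rewrite -[LHS]prednK ?size_exp // size_poly_gt0 expf_neq0 ?monic_neq0.
Qed.

(** * Digits *)

Definition of_digits (b m : nat) (v : nat -> nat) : nat :=
  (\sum_(r < m) v r.+1 * b ^ r)%N.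

Lemma of_digitsS b m v :
  of_digits b m.+1 v = (of_digits b m (v \o succn) * b + v 1)%N.
Proof.
rewrite /of_digits big_ord_recl muln1 addnC; congr (_ + _)%N.
by rewrite big_distrl /=; apply: eq_bigr => i _; rewrite expnSr mulnA.
Qed.

Lemma of_digits_lt b m v :
  (forall r, (v r < b)%N) -> (of_digits b m v < b ^ m)%N.
Proof.
elim: m v => [|m IH] v vb; first by rewrite /of_digits big_ord0.
rewrite of_digitsS expnSr; have := IH (v \o succn) (fun r => vb r.+1).
have := vb 1%N; nia.
Qed.

Lemma nat_digit1 b n : nat_digit b n 1 = (n %% b)%N.
Proof. by rewrite /nat_digit expn0 divn1. Qed.

Lemma nat_digitS b n r :
  (0 < r)%N -> nat_digit b n r.+1 = nat_digit b (n %/ b) r.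
Proof. by case: r => // r _; rewrite /nat_digit /= expnS divnMA. Qed.

Lemma nat_digit_of_digits b m v r :
  (forall r, (v r < b)%N) -> (0 < r <= m)%N ->
  nat_digit b (of_digits b m v) r = v r.
Proof.
case: r => // r; elim: r m v => [|r IH] [|m] v vb //= rm.
  by rewrite of_digitsS nat_digit1 modnMDl modn_small.
have b0 : (0 < b)%N := leq_ltn_trans (leq0n _) (vb 0%N).
rewrite nat_digitS // of_digitsS divnMDl // divn_small // addn0.
by rewrite IH // => i; apply: vb.
Qed.

Lemma nat_digit_small b m n r :
  (0 < b)%N -> (n < b ^ m)%N -> (m < r)%N -> nat_digit b n r = 0%N.
Proof.
move=> b0 nm mr.
rewrite /nat_digit divn_small ?mod0n //; apply: leq_trans nm _.
by apply: leq_pexp2l => //; lia.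
Qed.

Lemma nat_digit_lt b n r : (0 < b)%N -> (nat_digit b n r < b)%N.
Proof. exact: ltn_pmod. Qed.

(** [r] is the most significant place of disagreement; it is found by induction on the quotient by
    [b], the last digit deciding only when the quotients coincide. *)
Lemma ltn_nat_digit b n N : (1 < b)%N -> (n < N)%N ->
  exists r, [/\ (0 < r)%N, (nat_digit b n r < nat_digit b N r)%N &
    forall r', (r < r')%N -> nat_digit b n r' = nat_digit b N r'].
Proof.
move=> b1; elim/ltn_ind: N n => N IH n nN.
have [lt|ge] := ltnP (n %/ b) (N %/ b).
  have [|r [r0 rlt req]] := IH (N %/ b)%N _ (n %/ b)%N lt.
    by apply: ltn_Pdiv => //; apply: leq_ltn_trans nN.
  exists r.+1; split => [//||[//|r'] rr']; first by rewrite !nat_digitS.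
  have r'0 : (0 < r')%N by lia.
  by rewrite !nat_digitS // req.
have e : (n %/ b = N %/ b)%N.
  by apply/eqP; rewrite eqn_leq ge leq_div2r // ltnW.
exists 1%N; split => [//||[//|r'] rr'].
  rewrite !nat_digit1; move: nN; rewrite {1}(divn_eq n b) {1}(divn_eq N b) e.
  by rewrite ltn_add2l.
by rewrite !nat_digitS // e.
Qed.

Lemma nat_digit_inj b m n n' : (1 < b)%N -> (n < b ^ m)%N -> (n' < b ^ m)%N ->
  (forall r, (0 < r <= m)%N -> nat_digit b n r = nat_digit b n' r) -> n = n'.
Proof.
move=> b1.
wlog lt : n n' / (n < n')%N => [H|] nm n'm eq.
  by case: (ltngtP n n') => // h; [|apply: esym]; apply: H => // r rm; rewrite eq.
have [r [r0 rlt _]] := ltn_nat_digit b1 lt.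
case: (leqP r m) => rm; first by rewrite eq ?ltnn // r0 in rlt.
by rewrite !(nat_digit_small _ _ rm) // ltnW // in rlt.
Qed.

Lemma nat_shiftE b m n Q : nat_shift b m n Q =
  of_digits b m (fun r => (nat_digit b n r + nat_digit b Q r) %% b)%N.
Proof. by rewrite /nat_shift big_add1 big_mkord. Qed.

Lemma nat_digit_shift b m n Q r : (0 < b)%N -> (0 < r <= m)%N ->
  nat_digit b (nat_shift b m n Q) r
  = ((nat_digit b n r + nat_digit b Q r) %% b)%N.
Proof.
move=> b0 rm; rewrite nat_shiftE nat_digit_of_digits // => i.
exact: ltn_pmod.
Qed.

Lemma nat_shift_lt b m n Q : (0 < b)%N -> (nat_shift b m n Q < b ^ m)%N.
Proof.
by move=> b0; rewrite nat_shiftE; apply: of_digits_lt => i; apply: ltn_pmod.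
Qed.

Lemma modn_addr_inj b x y w : (x < b)%N -> (y < b)%N ->
  ((x + w) %% b = (y + w) %% b)%N -> x = y.
Proof.
by move=> xb yb /eqP; rewrite eqn_modDr !modn_small // => /eqP.
Qed.

Lemma card_le_digits (T : finType) (b : nat) (S : {set T})
    (hs : seq (T -> 'I_b)) :
  {in S &, forall n n', all (fun h => h n == h n') hs -> n = n'} ->
  (#|S| <= b ^ size hs)%N.
Proof.
move=> hinj; pose G n := map_tuple (fun h => h n) (in_tuple hs).
have Ginj : {in S &, injective G}.
  move=> n n' nS n'S /(congr1 val) /= e; apply: hinj => //.
  by elim: (hs) e => //= h r IH [-> /IH ->]; rewrite eqxx.
rewrite -(card_in_imset Ginj) (leq_trans (max_card _)) //.
by rewrite card_tuple card_ord.
Qed.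

(* The digits of gamma, numbered from 1: digit 1 at A, 2A, ..., kA. *)
Definition comb (A k l : nat) : bool := (A %| l)%N && (l <= A * k)%N.

Lemma sum_comb (V : nmodType) (A k m : nat) (f : nat -> V) :
  (0 < A)%N -> (A * k <= m)%N ->
  \sum_(l < m) (if comb A k l.+1 then f l.+1 else 0)
  = \sum_(j < k) f (A * j.+1)%N.
Proof.
move=> A0 Akm.
rewrite -(big_mkord xpredT (fun l => if comb A k l.+1 then f l.+1 else 0)).
rewrite (big_cat_nat (n := A * k)%N) //= [X in _ + X]big_nat_cond.
rewrite [X in _ + X]big1 ?addr0; last first.
  by move=> l; rewrite andbT /comb => /andP[h _]; rewrite ifF //; lia.
rewrite (@eq_big_nat _ _ _ _ _ _
  (fun l => if (A %| l.+1)%N then f l.+1 else 0)); last first.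
  by move=> l /andP[_ h]; rewrite /comb h andbT.
(* One block of [A] consecutive places at a time; only the last place of a block is a multiple of
   [A]. *)
elim: k {m Akm} => [|k IH]; first by rewrite muln0 big_nil big_ord0.
rewrite big_ord_recr /= -IH mulnS (big_cat_nat (n := A * k)%N) ?leq_addl //=.
congr (_ + _); case: A A0 {IH} => // A _.
rewrite addSn big_nat_recr ?leq_addl //=.
rewrite big_nat_cond big1 ?add0r; last first.
  move=> l; rewrite andbT => /andP[h1 h2]; rewrite ifF //; apply/negbTE.
  rewrite (_ : l.+1 = A.+1 * k + (l.+1 - A.+1 * k))%N; last by lia.
  rewrite dvdn_addr ?dvdn_mulr // gtnNdvd //; lia.
by rewrite ifT // -addSn -mulnS dvdn_mulr.
Qed.

Section RealDigits.
Variable R : realType.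

(** Reversing the digits turns a finite b-adic fraction into an integer over b^m, so that comparing
    fractions becomes comparing integers. *)
Lemma of_digits_rev (b m : nat) (v : nat -> nat) : (0 < b)%N ->
  (of_digits b m (fun r => v (m.+1 - r)%N))%:R / b%:R ^+ m
  = \sum_(l < m) (v l.+1)%:R / b%:R ^+ l.+1 :> R.
Proof.
move=> b0; have bn : b%:R != 0 :> R by rewrite pnatr_eq0 -lt0n.
rewrite /of_digits natr_sum mulr_suml (reindex_inj rev_ord_inj) /=.
apply: eq_bigr => i _; have hi := ltn_ord i.
rewrite (_ : m.+1 - (m - i.+1).+1 = i.+1)%N; last by lia.
rewrite natrM natrX -mulrA; congr (_ * _).
rewrite -[in b%:R ^+ m](subnK hi) exprD invfM mulrA divff ?mul1r //.
exact: expf_neq0.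
Qed.

Lemma badic_trunc_nat (b m W : nat) : (0 < b)%N -> (W < b ^ m)%N ->
  (forall j, (j <= m)%N ->
     real_digit b (W%:R / b%:R ^+ m : R) j = ((W %/ b ^ (m - j)) %% b)%N) /\
  badic_trunc b m (W%:R / b%:R ^+ m : R) = W%:R / b%:R ^+ m.
Proof.
move=> b0 Wm; have bn : b%:R != 0 :> R by rewrite pnatr_eq0 -lt0n.
have rd j : (j <= m)%N ->
    real_digit b (W%:R / b%:R ^+ m : R) j = ((W %/ b ^ (m - j)) %% b)%N.
  move=> jm; rewrite /real_digit; congr (_ %% _)%N.
  have p0 : 0 < (b ^ (m - j))%:R :> R by rewrite ltr0n expn_gt0 b0.
  have -> : W%:R / b%:R ^+ m * b%:R ^+ j = W%:R / (b ^ (m - j))%:R :> R.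
    rewrite -[in b%:R ^+ m](subnK jm) exprD invfM mulrA -mulrA natrX.
    by rewrite mulVf ?mulr1 // expf_neq0.
  apply: truncn_def; apply/andP; split.
    by rewrite ler_pdivlMr // -natrM ler_nat leq_divM.
  rewrite ltr_pdivrMr // -natrM ltr_nat -ltn_divLR // expn_gt0 b0 //.
split=> //; rewrite /badic_trunc.
suff H k : (k <= m)%N ->
    \sum_(1 <= j < k.+1) (real_digit b (W%:R / b%:R ^+ m : R) j)%:R / b%:R ^+ j
    = (W %/ b ^ (m - k))%:R / b%:R ^+ k :> R.
  by rewrite H // subnn divn1.
elim: k => [|k IH] km.
  by rewrite big_geq // subn0 divn_small // mul0r.
rewrite big_nat_recr //= IH 1?ltnW // rd //.
rewrite [in RHS](divn_eq (W %/ b ^ (m - k.+1)) b) natrD natrM mulrDl.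
congr (_ + _); rewrite -divnMA -expnSr -subSn //.
by rewrite exprSr -mulf_div divff ?mulr1.
Qed.

Lemma badic_value_ge (b m : nat) (v : nat -> nat) :
  (1 < b)%N -> (forall j, (v j < b)%N) ->
  \sum_(l < m) (v l.+1)%:R / b%:R ^+ l.+1 <= badic_value R b v.
Proof.
move=> b1 vb.
have b0 : 0 < b%:R :> R by rewrite ltr0n; lia.
pose u k : R := \sum_(1 <= j < k.+1) (v j)%:R / b%:R ^+ j.
have um : {homo u : i j / (i <= j)%N >-> i <= j}.
  apply/nondecreasing_seqP => k; rewrite /u [leRHS]big_nat_recr //=.
  by rewrite lerDl divr_ge0 // exprn_ge0 // ltW.
have uE k : u k = \sum_(l < k) (v l.+1)%:R / b%:R ^+ l.+1.
  by rewrite /u big_add1 big_mkord.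
have uc : cvgn u.
  apply: nondecreasing_is_cvgn => //; exists 1 => _ [k _ <-].
  have b0' : (0 < b)%N by lia.
  rewrite uE -of_digits_rev // ler_pdivrMr ?exprn_gt0 // mul1r -natrX ler_nat.
  by apply: ltnW; apply: of_digits_lt.
by rewrite -uE; apply: nondecreasing_cvgn_le.
Qed.

End RealDigits.

(** * Digits of the Niederreiter sequence *)

Lemma eq_big_ord_support (V : nmodType) (n m : nat) (f : nat -> V) :
  (forall r, (n <= r)%N -> f r = 0) -> (forall r, (m <= r)%N -> f r = 0) ->
  \sum_(r < n) f r = \sum_(r < m) f r.
Proof.
wlog nm : n m / (n <= m)%N => [H|] fn fm.
  by case: (leqP n m) => h; [exact: H | apply/esym/H => //; apply: ltnW].
rewrite (big_ord_widen m) // big_mkcond; apply: eq_bigr => i _.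
by case: ltnP => // /fn.
Qed.

Section NiederreiterDigits.
Variables (F : finFieldType) (s : nat).
Variables (psi : 'I_#|F| -> F) (psiV : F -> 'I_#|F|).
Variables (p : 'I_s -> {poly F}) (y : 'I_s -> nat -> nat -> {poly F}).
Variable a : 'I_s -> nat -> nat -> int -> F.

Local Notation b := #|F|.
Local Notation e := (fun i : 'I_s => pdeg (p i)).

Hypothesis psiK : cancel psi psiV.
Hypothesis psiVK : cancel psiV psi.
Hypothesis psi0 : psi (zero_digit F) = 0.
Hypothesis pm : forall i, p i \is monic.
Hypothesis pI : forall i, irreducible_poly (p i).
Hypothesis pinj : injective p.
Hypothesis yI : forall (i : 'I_s) (j : nat), (1 <= j)%N ->
  residues_lin_indep (p i) (e i) (y i j).
Hypothesis aE : forall (i : 'I_s) (j k : nat), (1 <= j)%N -> (k < e i)%N ->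
  laurent_expansion (y i j k) (p i ^+ j) (a i j k).

Definition coord_digit (n : nat) (i : 'I_s) (j : nat) : nat :=
  niederreiter_digit psi psiV (gen_matrix (e i) (a i)) n j.

Definition digit_poly (m n : nat) : {poly F} :=
  \poly_(r < m) psi (nat_digit_ord F n r.+1).

Lemma pdeg_gt0 i : (0 < e i)%N.
Proof. by rewrite /pdeg -subn1 subn_gt0; case: (pI i). Qed.

Lemma card_field_gt1 : (1 < b)%N.
Proof. exact: card_finNzRing_gt1. Qed.

Lemma psi_digit0 n r : nat_digit b n r = 0%N -> psi (nat_digit_ord F n r) = 0.
Proof. by move=> h; rewrite -psi0; congr psi; apply: val_inj. Qed.

(** The product of a matrix row with the digit vector of n is the coefficient of x^(-1) in z y /
    p^j, where z has the digits of n as coefficients. *)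
Lemma coord_digitE m n i j : (n < b ^ m)%N ->
  coord_digit n i j = psiV (laurent_mul (digit_poly m n)
    (a i (j.-1 %/ e i).+1 (j.-1 %% e i)%N) 1).
Proof.
move=> nm; have b1 := card_field_gt1; have b0 := ltnW b1.
rewrite /coord_digit /niederreiter_digit; congr (nat_of_ord (psiV _)).
rewrite (@laurent_mul_widen _ m) ?size_poly // big_add1 big_mkord /=.
pose f r := gen_matrix (e i) (a i) j r.+1 * psi (nat_digit_ord F n r.+1).
(* The digit is defined by a sum up to [n], the polynomial has [m] coefficients; the digits of [n]
   vanish beyond both bounds, as n < b^n and n < b^m. *)
rewrite (@eq_big_ord_support _ n m f).
- apply: eq_bigr => r _; rewrite /f coef_poly ltn_ord mulrC; congr (_ * _).
- move=> r nr; rewrite /f psi_digit0 ?mulr0 // (@nat_digit_small _ n) //.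
  exact: ltn_expl.
- by move=> r mr; rewrite /f psi_digit0 ?mulr0 // (@nat_digit_small _ m).
Qed.

Lemma coord_digit_lt n i j : (coord_digit n i j < b)%N.
Proof. exact: ltn_ord. Qed.

Lemma dvdp_digit_poly m n n' (u : 'I_s -> nat) :
  (n < b ^ m)%N -> (n' < b ^ m)%N ->
  (forall i j, (1 <= j <= e i * u i)%N ->
     coord_digit n i j = coord_digit n' i j) ->
  \prod_i p i ^+ u i %| digit_poly m n - digit_poly m n'.
Proof.
move=> nm n'm eqd; apply: dvdp_prod_irreducible => // i.
apply: (dvdp_exp_laurent (pm i) (pdeg_gt0 i) (yI (i := i)) (aE (i := i))).
move=> j k /andP[j0 ju] ke.
(* The first e_i u_i digits enumerate the pairs (j, k) with j <= u_i and k < e_i. *)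
have [J [J0 Jj Jk]] : exists J, [/\ (1 <= J <= e i * u i)%N,
    ((J.-1 %/ e i).+1 = j)%N & (J.-1 %% e i = k)%N].
  exists (j.-1 * e i + k).+1; split => /=.
  - have : (j.-1.+1 * e i <= u i * e i)%N by rewrite leq_mul2r prednK ?ju ?orbT.
    by rewrite mulSn /=; move: ke => /=; nia.
  - by rewrite divnMDl ?pdeg_gt0 // divn_small // addn0 prednK.
  - by rewrite modnMDl modn_small.
have := eqd i J J0; rewrite !(@coord_digitE m) // Jj Jk.
move=> /ord_inj /(can_inj psiVK) E.
apply: (addIr (laurent_mul (digit_poly m n') (a i j k) 1)).
by rewrite -laurent_mulDl subrK add0r.
Qed.

Lemma coef_digit_poly_sub_eq0 m n n' r : (r < m)%N ->
  ((digit_poly m n - digit_poly m n')`_r == 0)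
  = (nat_digit b n r.+1 == nat_digit b n' r.+1).
Proof.
move=> rm; rewrite coefB !coef_poly rm subr_eq0 (can_eq psiK).
by rewrite -val_eqE.
Qed.

(** The difference of the two digit polynomials is nonzero of degree below [r], yet divisible by the
    product of the p_i^(u_i), of degree \sum_i e_i u_i. *)
Lemma coord_digit_admissible m n n' r (u : 'I_s -> nat) :
  (n < b ^ m)%N -> (n' < b ^ m)%N ->
  (0 < r)%N -> nat_digit b n r != nat_digit b n' r ->
  (forall r', (r < r')%N -> nat_digit b n r' = nat_digit b n' r') ->
  (forall i j, (1 <= j <= e i * u i)%N ->
     coord_digit n i j = coord_digit n' i j) ->
  (\sum_i e i * u i < r)%N.
Proof.
move=> nm n'm r0 rne req eqd.
have b0 : (0 < b)%N := ltnW card_field_gt1.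
have rm : (r <= m)%N.
  rewrite leqNgt; apply: contra rne => mr.
  by rewrite !(@nat_digit_small _ m).
set z := digit_poly m n - digit_poly m n'.
have z0 : z != 0.
  apply: contra rne => /eqP z0.
  by rewrite -(prednK r0) -(@coef_digit_poly_sub_eq0 m) ?prednK // -/z z0 coef0.
have sz : (size z <= r)%N.
  apply/leq_sizeP => j rj; case: (ltnP j m) => jm.
    by apply/eqP; rewrite coef_digit_poly_sub_eq0 // req.
  by rewrite /z coefB !coef_poly !ltnNge jm subrr.
have := dvdp_leq z0 (dvdp_digit_poly nm n'm eqd).
by rewrite size_prod_monic_exp // => h; apply: leq_trans sz.
Qed.

(** For distinct indices the highest differing digit would lie above \sum_i e_i u_i by
    admissibility, where the index digits are assumed to agree. *)
Lemma coord_digit_inj m n n' M (u : 'I_s -> nat) :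
  (n < b ^ m)%N -> (n' < b ^ m)%N ->
  (forall r, (M < r)%N -> nat_digit b n r = nat_digit b n' r) ->
  (forall r, (\sum_i e i * u i < r <= M)%N ->
     nat_digit b n r = nat_digit b n' r) ->
  (forall i j, (1 <= j <= e i * u i)%N ->
     coord_digit n i j = coord_digit n' i j) ->
  n = n'.
Proof.
wlog lt : n n' / (n < n')%N => [H|] nm n'm hM hD eqd.
  case: (ltngtP n n') => // h; first exact: H.
  apply/esym; apply: H => //.
  - by move=> r rM; rewrite hM.
  - by move=> r rM; rewrite hD.
  by move=> i j ij; rewrite eqd.
have [r [r0 rlt req]] := ltn_nat_digit card_field_gt1 lt.
have rne : nat_digit b n r != nat_digit b n' r by rewrite ltn_eqF.
have D := coord_digit_admissible nm n'm r0 rne req eqd.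
exfalso; case: (ltnP M r) => rM; first by rewrite hM ?eqxx in rne.
by rewrite hD ?eqxx // D rM in rne.
Qed.

(** Rounding g_i - 1 down to a multiple of e_i loses at most e_i - 1 digits, so g_i <= e_i u_i +
    e_i; summing produces the defect d = \sum_i e_i. *)
Lemma box_empty m n n' M (g : 'I_s -> nat) :
  (n < b ^ m)%N -> (n' < b ^ m)%N ->
  nat_digit b n M.+1 != nat_digit b n' M.+1 ->
  (forall r, (M.+1 < r)%N -> nat_digit b n r = nat_digit b n' r) ->
  (forall i j, (1 <= j < g i)%N -> coord_digit n i j = coord_digit n' i j) ->
  (\sum_i g i <= M + \sum_i e i)%N.
Proof.
move=> nm n'm ne eqr eqd; pose u i := ((g i).-1 %/ e i)%N.
have ug i : (e i * u i <= (g i).-1)%N by rewrite mulnC leq_divM.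
have lt : (\sum_i e i * u i < M.+1)%N.
  apply: (coord_digit_admissible nm n'm) => // i j /andP[j0 ju].
  by apply: eqd; rewrite j0 /=; have := leq_trans ju (ug i); lia.
apply: leq_trans (_ : \sum_i (e i * u i + e i) <= _)%N.
  apply: leq_sum => i _; have := divn_eq (g i).-1 (e i).
  by have := ltn_pmod (g i).-1 (pdeg_gt0 i); rewrite /u /=; lia.
by rewrite big_split /= leq_add2r -ltnS.
Qed.

(* The digits of coordinate i are refined to the next multiple of e_i, at a total
   cost of at most \sum_i (e_i - 1); the refined digits together with the index
   digits above the number of refined digits determine the index. *)
Lemma box_card m N M (S : {set 'I_N}) (Q : 'I_N -> nat) (g : 'I_s -> nat) :
  {in S, forall n, Q n < b ^ m}%N -> {in S &, injective Q} ->
  {in S &, forall n n' r, (M < r)%N ->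
     nat_digit b (Q n) r = nat_digit b (Q n') r} ->
  {in S &, forall n n' i j, (1 <= j <= g i)%N ->
     coord_digit (Q n) i j = coord_digit (Q n') i j} ->
  (\sum_i g i + (\sum_i e i - s) <= M)%N ->
  (#|S| <= b ^ (M - \sum_i g i))%N.
Proof.
move=> Qm Qinj hM hg gM.
pose u i := ((g i + (e i).-1) %/ e i)%N; pose U i := (e i * u i)%N.
have gU i : (g i <= U i <= g i + (e i).-1)%N.
  have := divn_eq (g i + (e i).-1) (e i).
  by have := ltn_pmod (g i + (e i).-1) (pdeg_gt0 i); rewrite /U /u /=; lia.
have sUg : (\sum_i U i = \sum_i (U i - g i) + \sum_i g i)%N.
  rewrite -big_split; apply: eq_bigr => i _ /=; case/andP: (gU i) => h _.
  by rewrite subnK.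
have se : (\sum_i e i = \sum_(i < s) (e i).-1 + s)%N.
  have s1 : (\sum_(i < s) 1 = s)%N by rewrite sum1_card card_ord.
  rewrite -[X in _ = (_ + X)%N]s1 -big_split /=.
  by apply: eq_bigr => i _; rewrite addn1 prednK ?pdeg_gt0.
have UM : (\sum_i U i <= M)%N.
  apply: leq_trans gM; rewrite se addnK -big_split /=.
  by apply: leq_sum => i _; case/andP: (gU i).
pose cd n i j : 'I_b := Ordinal (coord_digit_lt n i j).
pose hs : seq ('I_N -> 'I_b) :=
  flatten [seq [seq (fun n : 'I_N => cd (Q n) i j)
                | j <- iota (g i).+1 (U i - g i)] | i <- index_enum 'I_s]
  ++ [seq (fun n : 'I_N => nat_digit_ord F (Q n) r)
      | r <- iota (\sum_i U i).+1 (M - \sum_i U i)].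
(* There are \sum_i (U_i - g_i) refining digits and M - \sum_i U_i index digits. *)
have shs : size hs = (M - \sum_i g i)%N.
  rewrite size_cat size_flatten /shape -map_comp size_map size_iota.
  rewrite sumnE big_map /=.
  rewrite (eq_bigr (fun i => U i - g i)%N); last first.
    by move=> i _; rewrite size_map size_iota.
  move: sUg UM; move: (\sum_(i < s) U i)%N (\sum_(i < s) (U i - g i))%N.
  by move=> x1 x2 -> h; rewrite addnBA // subnDl.
have all_flat (T : Type) (P : pred T) ss :
    all P (flatten ss) = all (all P) ss.
  by elim: ss => //= s0 ss <-; rewrite all_cat.
rewrite -shs; apply: card_le_digits => n n' nS n'S.
rewrite all_cat all_flat !all_map => /andP[/allP hx /allP hr].
apply: (Qinj) => //; apply: (@coord_digit_inj m _ _ M u); rewrite ?Qm //.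
- by move=> r; apply: hM.
- move=> r /andP[r1 r2]; have := hr r.
  by rewrite mem_iota addSn subnKC // ltnS r1 r2 => /(_ isT)/eqP/(congr1 val).
move=> i j /andP[j0 jU]; case: (leqP j (g i)) => jg.
  by apply: hg => //; rewrite j0.
have := hx i (mem_index_enum i) => /=; rewrite all_map => /allP /(_ j).
rewrite mem_iota addSn subnKC; last by case/andP: (gU i).
by rewrite ltnS jg jU => /(_ isT)/eqP/(congr1 val).
Qed.

End NiederreiterDigits.

(** * First places of departure from gamma and from N *)

Lemma nat_digit_top b m v l : (forall r, (v r < b)%N) -> (0 < l <= m)%N ->
  nat_digit b (of_digits b m (fun r => v (m.+1 - r)%N)) (m.+1 - l) = v l.
Proof.
move=> vb lm; rewrite nat_digit_of_digits //; last by lia.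
by congr v; lia.
Qed.

Lemma sum_comb_inv (R : realType) (b A k m : nat) : (0 < A)%N ->
  (A * k <= m)%N ->
  \sum_(l < m) (comb A k l.+1)%:R / b%:R ^+ l.+1
  = \sum_(j < k) (b%:R ^+ (A * j.+1))^-1 :> R.
Proof.
move=> A0 Akm; rewrite -(@sum_comb _ A k m (fun l => (b%:R ^+ l)^-1)) //.
by apply: eq_bigr => l _; case: comb; rewrite ?mul1r ?mul0r.
Qed.

(** Cutting after [m] places only lowers the value, while gamma is exact there. At the first place
    of disagreement the digit is smaller than that of gamma, which is at most 1: so gamma has a 1
    there, at some A (j+1), and [v] a 0. *)
Lemma badic_value_lt_comb (R : realType) (b A k m : nat) (v : nat -> nat) :
  (1 < b)%N -> (0 < A)%N -> (A * k <= m)%N -> (forall l, (v l < b)%N) ->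
  badic_value R b v < \sum_(j < k) (b%:R ^+ (A * j.+1))^-1 ->
  exists j : 'I_k, v (A * j.+1)%N = 0%N /\
    forall l, (0 < l < A * j.+1)%N -> v l = comb A k l.
Proof.
move=> b1 A0 Akm vb.
have b0 : (0 < b)%N := ltnW b1.
have cb l : (comb A k l < b)%N by case: comb.
move=> /(le_lt_trans (badic_value_ge R m b1 vb)).
rewrite -(@sum_comb_inv R b A k m) // -(@of_digits_rev R b m v) //.
rewrite -(@of_digits_rev R b m (comb A k)) //.
rewrite ltr_pM2r ?invr_gt0 ?exprn_gt0 ?ltr0n // ltr_nat.

move=> /(ltn_nat_digit b1)[r [r0 rlt req]].
have rm : (r <= m)%N.
  rewrite leqNgt; apply: contraTN rlt => mr.
  rewrite [X in (_ < X)%N](nat_digit_small b0 _ mr) //.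
  by apply: of_digits_lt => i; apply: cb.
pose l := (m.+1 - r)%N; have lm : (0 < l <= m)%N by rewrite /l; lia.
have rl : r = (m.+1 - l)%N by rewrite /l; lia.
rewrite rl (nat_digit_top vb) // (@nat_digit_top _ _ (comb A k)) // in rlt.
have [/andP[/dvdnP[j lE] lk] vl0] : comb A k l /\ v l = 0%N.
  by move: rlt; case: comb => //; case: (v l).
case: j lE => [|j] lE; first by move: lm; rewrite lE.
have jk : (j < k)%N by move: lk; rewrite lE mulnC leq_pmul2l.
exists (Ordinal jk) => /=; rewrite mulnC -lE; split=> // l' /andP[l'0 l'l].
have l'm : (0 < l' <= m)%N by lia.
have := req (m.+1 - l')%N.
rewrite (nat_digit_top vb) // (@nat_digit_top _ _ (comb A k)) //.
by apply; lia.
Qed.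

(** The integer b^m (b - 1) gamma, with gamma the fraction whose digits are [comb]; place l of gamma
    is the digit m + 1 - l here. *)
Definition comb_num (b A k m : nat) : nat :=
  of_digits b m (fun r => b.-1 * comb A k (m.+1 - r))%N.

Lemma comb_digit_lt b A k l : (1 < b)%N -> (b.-1 * comb A k l < b)%N.
Proof. by move=> b1; case: comb; rewrite ?muln1 ?muln0; lia. Qed.

Lemma comb_num_lt b A k m : (1 < b)%N -> (comb_num b A k m < b ^ m)%N.
Proof.
by move=> b1; apply: of_digits_lt => r; apply: comb_digit_lt.
Qed.

Lemma nat_digit_comb_num b A k m l : (1 < b)%N -> (0 < l <= m)%N ->
  nat_digit b (comb_num b A k m) (m.+1 - l) = (b.-1 * comb A k l)%N.
Proof.
move=> b1 lm; apply: (@nat_digit_top _ _ (fun l => b.-1 * comb A k l)%N) => //.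
by move=> r; apply: comb_digit_lt.
Qed.

(** The factor b - 1 is spread over a sum in [c], to be matched term by term with the possible time
    digits below b - 1. *)
Lemma comb_numE (R : realType) (b A k m : nat) : (1 < b)%N -> (0 < A)%N ->
  (A * k <= m)%N ->
  (comb_num b A k m)%:R = \sum_(c < b.-1) \sum_(j < k)
    b%:R ^+ m / b%:R ^+ (A * j.+1) :> R.
Proof.
move=> b1 A0 Akm.
have b0 : (0 < b)%N := ltnW b1.
have bn : b%:R ^+ m != 0 :> R by rewrite expf_neq0 // pnatr_eq0 -lt0n.
apply: (mulIf (x := (b%:R ^+ m)^-1)); first by rewrite invr_eq0.
rewrite /comb_num (@of_digits_rev R b m (fun l => b.-1 * comb A k l)%N) //.
rewrite sumr_const card_ord -[_ *+ b.-1]mulr_natl.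
rewrite (eq_bigr (fun l : 'I_m => (b.-1)%:R *
  ((comb A k l.+1)%:R / b%:R ^+ l.+1 : R))); last first.
  by move=> l _; rewrite natrM mulrA.
rewrite -mulr_sumr sum_comb_inv // -mulrA; congr (_ * _).
rewrite mulr_suml; apply: eq_bigr => j _.
by rewrite mulrAC divff // mul1r.
Qed.

(** At the highest differing place the digit of N exceeds another digit, so it is b - 1 and the
    place belongs to the comb. *)
Lemma ltn_comb_num b A k m n : (1 < b)%N -> (0 < A)%N -> (A * k <= m)%N ->
  (n < comb_num b A k m)%N ->
  exists (c : 'I_b.-1) (j : 'I_k), nat_digit b n (m - A * j.+1).+1 = c /\
    forall r, ((m - A * j.+1).+1 < r)%N ->
      nat_digit b n r = nat_digit b (comb_num b A k m) r.
Proof.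
move=> b1 A0 Akm /(ltn_nat_digit b1)[r [r0 rlt req]].
have b0 : (0 < b)%N := ltnW b1.
have rm : (r <= m)%N.
  rewrite leqNgt; apply: contraTN rlt => mr.
  by rewrite [X in (_ < X)%N](nat_digit_small b0 (comb_num_lt _ _ _ b1) mr).
pose l := (m.+1 - r)%N; have lm : (0 < l <= m)%N by rewrite /l; lia.
have rl : r = (m.+1 - l)%N by rewrite /l; lia.
have cl : comb A k l.
  by move: rlt; rewrite rl nat_digit_comb_num //; case: comb; rewrite ?muln0.
have cb : (nat_digit b n r < b.-1)%N.
  by apply: leq_trans rlt _; rewrite rl nat_digit_comb_num // cl muln1.
move: cl => /andP[/dvdnP[j lE] lk].
case: j lE => [|j] lE; first by move: lm; rewrite lE.
have jk : (j < k)%N by move: lk; rewrite lE mulnC leq_pmul2l.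
have rE : r = (m - A * j.+1).+1 by rewrite mulnC -lE rl; lia.
by exists (Ordinal cb), (Ordinal jk) => /=; rewrite -rE.
Qed.

Lemma nat_shift_inj b m Q n n' : (1 < b)%N -> (n < b ^ m)%N ->
  (n' < b ^ m)%N -> nat_shift b m n Q = nat_shift b m n' Q -> n = n'.
Proof.
move=> b1 nm n'm E; apply: (nat_digit_inj b1 nm n'm) => r rm.
have b0 : (0 < b)%N := ltnW b1.
apply: (@modn_addr_inj b _ _ (nat_digit b Q r)); rewrite ?nat_digit_lt //.
by rewrite -!(nat_digit_shift _ _ _ rm) ?E.
Qed.

Lemma nat_digit_shift_eq b m Q n n' r : (0 < b)%N -> (0 < r)%N ->
  nat_digit b n r = nat_digit b n' r ->
  nat_digit b (nat_shift b m n Q) r = nat_digit b (nat_shift b m n' Q) r.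
Proof.
move=> b0 r0 E; case: (leqP r m) => rm.
  by rewrite !nat_digit_shift ?r0 // E.
by rewrite !(nat_digit_small b0 (nat_shift_lt _ _ _ b0) rm).
Qed.

Lemma card_le_sum (T I : finType) (P : pred T) (S : I -> {set T}) :
  (forall n, P n -> exists q, n \in S q) -> (#|P| <= \sum_q #|S q|)%N.
Proof.
move=> PS; have -> : (\sum_q #|S q| = \sum_n \sum_q (n \in S q))%N.
  rewrite exchange_big /=; apply: eq_bigr => q _.
  by rewrite -sum1_card big_mkcond; apply: eq_bigr => n _; case: (n \in S q).
rewrite -sum1_card big_mkcond; apply: leq_sum => n _; case: ifP => // Pn.
by have [q nq] := PS n Pn; rewrite (bigD1 q) //= nq.
Qed.

(** * Admissible nets *)

Section LowerBound.
Variables (R : realType) (b m s d t A k : nat).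
Variable x : nat -> 'I_s -> nat -> nat.

Hypothesis b1 : (1 < b)%N.
Hypothesis x_lt : forall n i j, (x n i j < b)%N.
Hypothesis x_admissible : forall n n' M (g : 'I_s -> nat),
  (n < b ^ m)%N -> (n' < b ^ m)%N ->
  nat_digit b n M.+1 != nat_digit b n' M.+1 ->
  (forall r, (M.+1 < r)%N -> nat_digit b n r = nat_digit b n' r) ->
  (forall i j, (1 <= j < g i)%N -> x n i j = x n' i j) ->
  (\sum_i g i <= M + d)%N.
Hypothesis x_net : forall N M (S : {set 'I_N}) (h : 'I_N -> nat)
    (g : 'I_s -> nat),
  {in S, forall n, h n < b ^ m}%N -> {in S &, injective h} ->
  {in S &, forall n n' r, (M < r)%N ->
     nat_digit b (h n) r = nat_digit b (h n') r} ->
  {in S &, forall n n' i j, (1 <= j <= g i)%N -> x (h n) i j = x (h n') i j} ->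
  (\sum_i g i + t <= M)%N -> (#|S| <= b ^ (M - \sum_i g i))%N.
Hypothesis AE : A = (d + t).+1.
Hypothesis k0 : (0 < k)%N.
Hypothesis Akm : (A * k + t <= m)%N.
Variable Q : nat.

Let b0 : (0 < b)%N := ltnW b1.
Let bR0 : 0 < b%:R :> R. Proof. by rewrite ltr0n. Qed.
Let A0 : (0 < A)%N. Proof. by rewrite AE. Qed.
(** The [t] places below the comb make the net condition for a piece equivalent to level at most
    [k]. *)
Let m1 := (A * k + t)%N.
Let N := comb_num b A k m1.
Let sh n := nat_shift b m n Q.
(* w is chosen so that the shifted point of index N is gamma up to place m. *)
Let wd i l := ((comb A k l + (b - x (sh N) i l)) %% b)%N.
Let w i : R := (of_digits b m (fun r => wd i (m.+1 - r)%N))%:R / b%:R ^+ m.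
Let v n i l := ((x (sh n) i l + real_digit b (w i) l) %% b)%N.
Let pt n i : R := digital_shift b (x (sh n) i) (w i).
Let G : R := \sum_(j < k) (b%:R ^+ (A * j.+1))^-1.
Let lvl (j : 'I_k) (f : {ffun 'I_s -> 'I_k}) : nat :=
  (j.+1 + \sum_i (f i).+1)%N.

Let wd_lt i l : (wd i l < b)%N. Proof. exact: ltn_pmod. Qed.
Let w_lt i : (of_digits b m (fun r => wd i (m.+1 - r)) < b ^ m)%N.
Proof. exact: of_digits_lt. Qed.

Let real_digit_w i l : (0 < l <= m)%N -> real_digit b (w i) l = wd i l.
Proof.
move=> /andP[l0 lm].
rewrite (badic_trunc_nat R b0 (w_lt i)).1 // -(@nat_digit_top b m (wd i)) ?l0 //.
by rewrite /nat_digit subSn.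
Qed.

Let w_in_E i : Eset b m (w i).
Proof.
exists (w i); last exact: (badic_trunc_nat R b0 (w_lt i)).2.
rewrite /= /w divr_ge0 ?exprn_ge0 ?ler0n //=.
by rewrite ltr_pdivrMr ?exprn_gt0 // mul1r -natrX ltr_nat.
Qed.

Let v_N i l : (0 < l <= m)%N -> v N i l = comb A k l.
Proof.
move=> lm; rewrite /v real_digit_w // /wd modnDmr addnCA subnKC; last first.
  by rewrite ltnW.
by rewrite modnDr modn_small //; case: comb.
Qed.

Let v_eq n n' i l : v n i l = v n' i l -> x (sh n) i l = x (sh n') i l.
Proof. exact: modn_addr_inj. Qed.

Let m1m : (m1 <= m)%N := Akm.
Let Akm1 : (A * k <= m1)%N. Proof. exact: leq_addr. Qed.

Let bm1m : (b ^ m1 <= b ^ m)%N. Proof. by rewrite leq_exp2l. Qed.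

Let Nlt : (N < b ^ m1)%N. Proof. exact: comb_num_lt. Qed.

(* A piece only asks for the first place where the point leaves gamma (at A j_i)
   and the index leaves N (at M.+1). *)
Let piece (c : 'I_b.-1) (j : 'I_k) (f : {ffun 'I_s -> 'I_k}) (n : nat) : Prop :=
  let M := (m1 - A * j.+1)%N in
  [/\ nat_digit b n M.+1 = c,
      (forall r, (M.+1 < r)%N -> nat_digit b n r = nat_digit b N r) &
      forall i, v n i (A * (f i).+1)%N = 0%N /\
        forall l, (0 < l < A * (f i).+1)%N -> v n i l = comb A k l].

(** The time index departs from N, and each coordinate from gamma, at a first place of the comb. *)
Let cover n : (n < N)%N -> (forall i, pt n i < G) ->
  exists c j f, piece c j f n.
Proof.
move=> nN nG.
have [c [j [hc hr]]] := ltn_comb_num b1 A0 Akm1 nN.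
have Akm' : (A * k <= m)%N := leq_trans Akm1 m1m.
have /choice[f hf] i : exists j : 'I_k, v n i (A * j.+1)%N = 0%N /\
    forall l, (0 < l < A * j.+1)%N -> v n i l = comb A k l.
  apply: (@badic_value_lt_comb R b A k m) => //.
    by move=> l; apply: ltn_pmod.
  exact: nG.
by exists c, j, (finfun f); split=> // i; rewrite ffunE.
Qed.

Let Aj (j : 'I_k) : (A * j.+1 <= A * k)%N.
Proof. by rewrite leq_pmul2l. Qed.

Let piece_x_eq c j f n i l : piece c j f n -> (0 < l < A * (f i).+1)%N ->
  x (sh n) i l = x (sh N) i l.
Proof.
move=> [_ _ /(_ i)[_ hl]] lf; apply: v_eq; rewrite hl // v_N //.
case/andP: lf => -> /= lf; apply: leq_trans m1m; apply: leq_trans Akm1.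
exact: leq_trans (ltnW lf) (Aj _).
Qed.

Let sum_lvl j f : (A * lvl j f = A * j.+1 + \sum_i A * (f i).+1)%N.
Proof. by rewrite /lvl mulnDr big_distrr. Qed.

(** Admissibility against the point of index [N] bounds A times the level by m1 + d = A k + t + d,
    which is below A (k + 1) by the choice A = d + t + 1. *)
Let piece_lvl c j f n : (n < N)%N -> piece c j f n -> (lvl j f <= k)%N.
Proof.
move=> nN pn; have [hc hr hx] := pn; set M := (m1 - A * j.+1)%N in hc hr.
have Mm1 : (M.+1 <= m1)%N.
  by rewrite /M; have := Aj j; rewrite /m1; have := A0; nia.
have h : (\sum_i A * (f i).+1 <= M + d)%N.
  apply: (@x_admissible (sh n) (sh N)).
  - exact: nat_shift_lt.
  - exact: nat_shift_lt.
  - have Mm : (0 < M.+1 <= m)%N by rewrite /= (leq_trans Mm1).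
    (* The time digits are c < b - 1 and b - 1; adding the same digit of [Q] modulo [b] keeps them
       distinct. *)
    rewrite !nat_digit_shift //; apply/eqP => /modn_addr_inj E.
    have := E (nat_digit_lt _ _ b0) (nat_digit_lt _ _ b0).
    have -> : M.+1 = (m1.+1 - A * j.+1)%N by rewrite subSn // (leq_trans (Aj j)).
    rewrite nat_digit_comb_num //; last first.
      by rewrite muln_gt0 A0 /= (leq_trans (Aj j)).
    rewrite subSn; last by rewrite (leq_trans (Aj j)).
    rewrite -/M hc /comb dvdn_mulr // Aj muln1 => cE.
    by have := ltn_ord c; rewrite cE ltnn.
  - by move=> r rM; apply: nat_digit_shift_eq; rewrite ?hr //; apply: leq_trans rM.
  by move=> i l lf; apply: (piece_x_eq pn).
rewrite -ltnS -(ltn_pmul2l A0) sum_lvl.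
apply: leq_ltn_trans (_ : A * j.+1 + (M + d) < _)%N; first by rewrite leq_add2l.
rewrite addnA subnKC ?(leq_trans (Aj j)) // /m1 mulnS.
by rewrite [X in (_ < X + _)%N]AE; lia.
Qed.

Let card_piece c j f (S : {set 'I_N}) : (forall n, n \in S -> piece c j f n) ->
  (#|S| <= if lvl j f <= k then b ^ (m1 - A * lvl j f) else 0)%N.
Proof.
move=> Sp; case: ifPn => jk; last first.
  rewrite leqn0 cards_eq0; apply/eqP/setP => n; rewrite inE.
  apply: contraNF jk => /Sp; apply: piece_lvl; exact: ltn_ord.
rewrite sum_lvl subnDA.
have lt (n : 'I_N) : (n < b ^ m)%N.
  by apply: leq_trans bm1m; apply: ltn_trans Nlt.
apply: (@x_net _ _ _ (fun n => sh n)).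
- by move=> n _; apply: nat_shift_lt.
- move=> n n' _ _ /nat_shift_inj E; apply/ord_inj; exact: E.
- move=> n n' /Sp[c1 r1 _] /Sp[c2 r2 _] r rM; apply: nat_digit_shift_eq => //.
    exact: leq_trans rM.
  move: rM; rewrite leq_eqVlt => /predU1P[<-|rM]; first by rewrite c1 c2.
  by rewrite r1 ?r2.
- move=> n n' nS n'S i l /andP[l0]; rewrite leq_eqVlt => /predU1P[->|lf].
    apply: v_eq; case: (Sp _ nS) (Sp _ n'S) => _ _ /(_ i)[-> _].
    by case=> _ _ /(_ i)[-> _].
  by rewrite !(piece_x_eq (Sp _ _)) ?l0.
rewrite leq_subRL; last by rewrite (leq_trans (Aj j)).
by rewrite addnA -sum_lvl /m1 leq_add2r leq_pmul2l.
Qed.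

(** The expected number of points of a piece, as a real quotient because the exponent is negative
    from level k + 1 on. *)
Let vol j f : R := b%:R ^+ m1 / b%:R ^+ (A * lvl j f).

Let box_count_le : (box_count N pt (fun=> G))%:R <=
  \sum_(c < b.-1) \sum_j \sum_f (if (lvl j f <= k)%N then vol j f else 0).
Proof.
pose S (q : 'I_b.-1 * 'I_k * {ffun 'I_s -> 'I_k}) : {set 'I_N} :=
  [set n : 'I_N | `[< piece q.1.1 q.1.2 q.2 n >]].
have h : (box_count N pt (fun=> G) <= \sum_q #|S q|)%N.
  apply: card_le_sum => n /forallP nG.
  have [c [j [f pn]]] : exists c j f, piece c j f n.
    by apply: cover => [|i]; [exact: ltn_ord | case/andP: (nG i)].
  by exists (c, j, f); rewrite inE; apply/asboolP.
apply: (@le_trans _ _ (\sum_q #|S q|)%:R); first by rewrite ler_nat.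
rewrite pair_bigA pair_bigA natr_sum /=; apply: ler_sum => -[[c j] f] _ /=.
have := @card_piece c j f (S (c, j, f)).
rewrite -(ler_nat R) => /(_ _)/le_trans; apply.
  by move=> n; rewrite inE => /asboolP.
case: ifP => // jk.
have le : (A * lvl j f <= m1)%N by apply/leq_trans/Akm1; rewrite leq_pmul2l.
rewrite natrX /vol -[in leRHS](subnK le) exprD mulfK //.
by rewrite expf_neq0 // gt_eqF.
Qed.

(** Expanding the product of the sums for N and for the [s] copies of gamma gives one term per
    piece. *)
Let volE : N%:R * \prod_(i < s) G = \sum_(c < b.-1) \sum_j \sum_f vol j f.
Proof.
have bn : b%:R != 0 :> R by rewrite gt_eqF.
rewrite comb_numE // mulr_suml; apply: eq_bigr => c _.
rewrite mulr_suml; apply: eq_bigr => j _.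
rewrite bigA_distr_bigA mulr_sumr; apply: eq_bigr => f _.
rewrite -mulrA; congr (_ * _).
by rewrite prodfV -expr_sum -invfM -exprD -sum_lvl.
Qed.

(** The deficit is at least the total volume of the pieces of level above [k]; K^s of them, for each
    [c], have level exactly k + 1. *)
Let box_discr (K : nat) : (s * K <= k)%N -> (0 < s)%N ->
  (b.-1 * K ^ s)%:R / b%:R ^+ d.+1 <= - local_discr N pt (fun=> G).
Proof.
move=> sK s0; rewrite /local_discr opprB volE.
apply: le_trans (lerB (lexx _) box_count_le).
rewrite -sumrB natrM -mulrA mulr_natl -[b.-1 in leLHS]card_ord -sumr_const.
apply: ler_sum => c _; rewrite -sumrB.
under eq_bigr => j _ do rewrite -sumrB.
rewrite exchange_big /=.
(* If all f_i < K, the coordinates contribute at most s K <= k to the level. *)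
pose small := [pred i : 'I_k | (i < K)%N].
have vol0 j f : 0 <= vol j f by rewrite divr_ge0 ?exprn_ge0 ?ltW.
have diff0 j f : 0 <= vol j f - (if (lvl j f <= k)%N then vol j f else 0).
  by case: ifP; rewrite ?subrr ?subr0.
have Kk : (K <= k)%N by apply: leq_trans sK; rewrite leq_pmull.
have card_small : #|small| = K.
  rewrite -[RHS]card_ord -!sum1_card (big_ord_widen k (fun=> 1%N) Kk).
  exact: eq_bigl.
rewrite -card_small -[s in (_ ^ s)%N]card_ord -card_ffun_on.
rewrite mulr_natl -sumr_const [leRHS](bigID (mem (ffun_on small))) /=.
rewrite -[leLHS]addr0; apply: lerD; last first.
  by apply: sumr_ge0 => f _; apply: sumr_ge0 => j _.
apply: ler_sum => f /ffun_onP fK.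
have sf : (\sum_i (f i).+1 <= k)%N.
  apply: leq_trans sK; rewrite -[s in (s * _)%N]card_ord -sum_nat_const.
  by apply: leq_sum => i _; apply: fK.
have sf0 : (0 < \sum_i (f i).+1)%N.
  by rewrite (bigD1 (Ordinal s0)) //= addSn.
(* This time index raises the level to exactly k + 1, since [j] counts from 0. *)
have jk : (k - \sum_i (f i).+1 < k)%N by rewrite ltn_subrL sf0.
rewrite (bigD1 (Ordinal jk)) //=.
have lE : lvl (Ordinal jk) f = k.+1 by rewrite /lvl /= addSn subnK.
rewrite /vol lE ltnn subr0 -[leLHS]addr0; apply: lerD; last first.
  by apply: sumr_ge0 => j _; exact: diff0.
have -> : (A * k.+1 = m1 + d.+1)%N by rewrite mulnS [X in (X + _)%N]AE /m1; lia.
by rewrite exprD invfM mulrA divff ?mul1r // expf_neq0 // gt_eqF.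
Qed.

Let G01 : 0 < G <= 1.
Proof.
have inv0 j : 0 < (b%:R ^+ (A * j))^-1 :> R by rewrite invr_gt0 exprn_gt0.
apply/andP; split.
  rewrite /G; case: k k0 => // k' _; rewrite big_ord_recl ltr_pwDl //.
  by apply: sumr_ge0 => i _; rewrite ltW.
rewrite /G -(@sum_comb_inv R b A k m1) //.
have cb l : (comb A k l < b)%N by case: comb.
rewrite -(@of_digits_rev R b m1 (comb A k)) // ler_pdivrMr ?exprn_gt0 //.
by rewrite mul1r -natrX ler_nat ltnW // of_digits_lt.
Qed.

Let N0 : (0 < N)%N.
Proof.
have bp : (0 < b.-1)%N by rewrite ltn_predRL.
rewrite -(ltr_nat R) /N comb_numE // sumr_const card_ord pmulrn_lgt0 //.
case: k k0 => // k' _; rewrite big_ord_recl ltr_pwDl ?divr_gt0 ?exprn_gt0 //.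
by apply: sumr_ge0 => i _; rewrite divr_ge0 ?exprn_ge0 ?ltW.
Qed.

(** Count and expected count both lie between 0 and N'. Boundedness is what makes [sup] a genuine
    supremum. *)
Let star_ubound N' (q : nat -> 'I_s -> R) : (0 < N')%N ->
  ubound [set `|local_discr N' q g| / N'%:R | g in
            [set g : 'I_s -> R | forall i, 0 < g i <= 1]]%classic 1.
Proof.
move=> N'0 _ [g g01 <-]; have N'R : 0 < N'%:R :> R by rewrite ltr0n.
rewrite ler_pdivrMr // mul1r ler_norml /local_discr.
have c0 : (box_count N' q g <= N')%N.
  by rewrite -[leqRHS]card_ord; apply: max_card.
have g0 : 0 <= \prod_i g i by apply: prodr_ge0 => i _; case/andP: (g01 i) => /ltW.
have g1 : \prod_i g i <= 1.
  by apply: prodr_ile1 => i _; case/andP: (g01 i) => /ltW ->.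
have := mulr_ge0 (ltW N'R) g0; have := ler_piMr (ltW N'R) g1.
move: c0; rewrite -(ler_nat R); have := ler0n R (box_count N' q g).
by move: (_ * _) => P; lra.
Qed.

Lemma max_shifted_discr_ge (K : nat) : (s * K <= k)%N -> (0 < s)%N ->
  (b.-1 * K ^ s)%:R / b%:R ^+ d.+1 <= max_shifted_discr R b m x Q.
Proof.
move=> sK s0; apply: le_trans (box_discr sK s0) _.
have NR : 0 < N%:R :> R by rewrite ltr0n.
have starN : - local_discr N pt (fun=> G) <= N%:R * star_discr N pt.
  apply: le_trans (ler_norm _) _; rewrite normrN mulrC -ler_pdivrMr //.
  apply: ub_le_sup; first by exists 1; apply: star_ubound.
  by exists (fun=> G).
apply: le_trans starN _; apply: ub_le_sup; last first.
  exists N, w; split => //; rewrite N0 /=.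
  by apply: ltnW; apply: leq_trans bm1m.
(* The outer supremum is bounded too: N' D* <= N' <= b^m. *)
exists (b ^ m)%:R => _ [N' [w' [/andP[N'0 N'm] _ ->]]].
apply: (@le_trans _ _ N'%:R); last by rewrite ler_nat.
rewrite ler_piMr ?ler0n //; apply: ge_sup; last exact: star_ubound.
by eexists; exists (fun=> 1) => // i; rewrite ltr01 lexx.
Qed.

End LowerBound.

(** * Minimum over Q and the numerical constant *)

Lemma minmax_shifted_discr_ge (R : realType) (b m s : nat)
    (x : nat -> 'I_s -> nat -> nat) (c : R) : (0 < b)%N ->
  (forall Q, c <= max_shifted_discr R b m x Q) ->
  c <= minmax_shifted_discr R b m x.
Proof.
move=> b0 h; apply: lb_le_inf; last by move=> _ [Q _ <-].
by exists (max_shifted_discr R b m x 0%N), 0%N => //=; rewrite expn_gt0 b0.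
Qed.

(** With D = d + t, both roundings give m < 2 D s (K + 1) + D s. For s >= 2 the bound m >= 9 D s^2
    forces K >= 2 and the excess is absorbed by the extra factor [s]; for s = 1 an additive 4 D
    remains. *)
Lemma levin_constant_nat (s d t m : nat) : (0 < s)%N -> (0 < d)%N ->
  (9 * (d + t) * s ^ 2 <= m)%N ->
  let K := ((m - t) %/ (d + t).+1 %/ s)%N in
  if s == 1%N then (m <= 4 * (d + t) + 2 * (d + t) * K)%N
  else (m <= 2 * (d + t) * s ^ 2 * K)%N.
Proof.
move=> s0 d0 hm /=; set k := ((m - t) %/ (d + t).+1)%N.
set K := (k %/ s)%N.
have tD : (t < d + t)%N by lia.
have km : (m < (d + t).+1 * k.+1 + t)%N.
  have := ltn_ceil (m - t) (ltn0Sn (d + t)); rewrite -/k mulnC.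
  by move: (_.+1 * _)%N => z; lia.
have Kk : (k < s * K.+1)%N by rewrite mulnC /K ltn_ceil.
clearbody K k; move: (d + t)%N tD hm km => D tD hm km.
have D2 : (D.+1 * k.+1 <= 2 * D * k.+1)%N by apply: leq_mul => //; lia.
have kK : (2 * D * k.+1 <= 2 * D * (s * K.+1))%N by rewrite leq_mul2l Kk orbT.
case: eqP => [es|s1]; first by move: kK; rewrite es mul1n; lia.
have s2 : (2 <= s)%N by lia.
have DP : (D <= D * s)%N by rewrite leq_pmulr.
have mP : (m < 2 * (D * s) * K.+1 + D * s)%N by lia.
have h9 : (9 * (D * s) * s <= m)%N by lia.
rewrite (_ : 2 * D * s ^ 2 * K = 2 * (D * s) * s * K)%N; last by lia.
have P0 : (0 < D * s)%N by lia.
move: (D * s)%N P0 mP h9 => P P0 mP h9.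
have K2 : (2 <= K)%N by nia.
have : (2 * P * 2 * K <= 2 * P * s * K)%N by rewrite leq_mul2r leq_mul2l s2 !orbT.
nia.
Qed.

Lemma levin_constant (R : realType) (b s d t m K : nat) :
  (1 < b)%N -> (0 < s)%N -> (0 < d)%N -> (9 * (d + t) * s ^ 2 <= m)%N ->
  K = ((m - t) %/ (d + t).+1 %/ s)%N ->
  b%:R ^- d * (4 * (d + t) * s ^ 2)%:R ^- s * m%:R ^+ s
    <= 1 + (b.-1 * K ^ s)%:R / b%:R ^+ d.+1 :> R.
Proof.
move=> b1 s0 d0 hm KE.
have := levin_constant_nat s0 d0 hm; rewrite -KE /=.
have D0 : (0 < d + t)%N by lia.
move: (d + t)%N D0 => D D0 {hm KE} hK.
have bR : 2 <= b%:R :> R by rewrite (ler_nat R 2).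
have q0 : 0 < (4 * D * s ^ 2)%:R :> R by rewrite ltr0n !muln_gt0 D0 s0.
(* For s = 1 the leftover 4 D yields the summand 1; for s >= 2 one uses (K/2)^s <= K^s / 2. *)
have key : (m%:R / (4 * D * s ^ 2)%:R) ^+ s <= 1 + (K ^ s)%:R / 2 :> R.
  case: eqP hK => [es|s1].
    subst s; rewrite expr1 ler_pdivrMr // expn1.
    rewrite -(ler_nat R) natrD !natrM => h.
    have -> : (1 ^ 2)%N%:R = 1 :> R by [].
    by move: h; rewrite mulr1; lra.
  rewrite -(ler_nat R) => h; rewrite !natrM in h.
  have hK2 : m%:R / (4 * D * s ^ 2)%:R <= K%:R / 2 :> R.
    by rewrite ler_pdivrMr // !natrM; lra.
  apply: (@le_trans _ _ ((K%:R / 2) ^+ s)).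
    by apply: lerXn2r => //; rewrite nnegrE divr_ge0.
  apply: (@le_trans _ _ ((K ^ s)%:R / 2)); last by rewrite lerDr.
  rewrite expr_div_n natrX ler_wpM2l ?exprn_ge0 ?ler0n //.
  rewrite lef_pV2 ?posrE ?exprn_gt0 // -[leLHS]expr1 ler_weXn2l //.
  by rewrite ler1n.
have bd0 : 0 < b%:R ^- d :> R by rewrite invr_gt0 exprn_gt0 // (lt_le_trans _ bR).
have bd1 : b%:R ^- d <= 1 :> R.
  by rewrite invf_le1 ?exprn_gt0 ?exprn_ege1 ?ler1n ?ltr0n // ltnW.
rewrite -mulrA; apply: le_trans (ler_wpM2l (ltW bd0) _) _.
  by rewrite -exprVn -exprMn mulrC; exact: key.
rewrite mulrDr mulr1 lerD //.
rewrite natrM exprS invfM.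
have -> : b.-1%:R = b%:R - 1 :> R by rewrite -subn1 natrB // ltnW.
(* The b - 1 time digits against one factor [b] of b^(d+1) pay for the 1/2. *)
have h2 : 2^-1 <= (b%:R - 1) / b%:R :> R.
  by rewrite ler_pdivlMr ?(lt_le_trans _ bR) //; lra.
have KS : 0 <= b%:R ^- d * (K ^ s)%:R :> R by rewrite mulr_ge0 ?ler0n ?ltW.
rewrite mulrA [leRHS](_ : _ = b%:R ^- d * (K ^ s)%:R * ((b%:R - 1) / b%:R)).
  exact: ler_wpM2l.
by ring.
Qed.

Theorem theorem3 (R : realType) (F : finFieldType) (s : nat)
  (psi : 'I_#|F| -> F) (psiV : F -> 'I_#|F|)
  (p : 'I_s -> {poly F})
  (y : 'I_s -> nat -> nat -> {poly F})
  (a : 'I_s -> nat -> nat -> int -> F) :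
  let b := #|F| in
  let e := fun i : 'I_s => pdeg (p i) in
  let x := fun (n : nat) (i : 'I_s) (j : nat) =>
    niederreiter_digit psi psiV (gen_matrix (e i) (a i)) n j in
  let e0 := (\sum_(i < s) e i)%N in
  let d := e0 in
  let t := (e0 - s)%N in
  (1 <= s)%N ->
  cancel psi psiV -> cancel psiV psi ->
  psi (zero_digit F) = 0 ->
  (forall i, p i \is monic) ->
  (forall i, irreducible_poly (p i)) ->
  injective p ->
  (forall (i : 'I_s) (j : nat), (1 <= j)%N ->
     residues_lin_indep (p i) (e i) (y i j)) ->
  (forall (i : 'I_s) (j k : nat), (1 <= j)%N -> (k < e i)%N ->
     laurent_expansion (y i j k) (p i ^+ j) (a i j k)) ->
  forall m : nat, (9 * (d + t) * s ^ 2 <= m)%N ->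
    b%:R ^- d * (4 * (d + t) * s ^ 2)%:R ^- s * m%:R ^+ s
      <= 1 + minmax_shifted_discr R b m x.
Proof.
move=> b e x e0 d t s0 psiK psiVK psi0 pm pI pinj yI aE m hm.
have b1 : (1 < b)%N := card_field_gt1 F.
have d0 : (0 < d)%N.
  rewrite /d /e0 (bigD1 (Ordinal s0)) //= ltn_addr //.
  exact: (pdeg_gt0 pI).
(* [k] is the largest number of comb places with A k + t <= m. *)
pose k := ((m - t) %/ (d + t).+1)%N; pose K := (k %/ s)%N.
have m9 : (9 * (d + t) <= m)%N.
  by apply: leq_trans hm; rewrite leq_pmulr // expn_gt0 s0.
have k0 : (0 < k)%N by rewrite divn_gt0 //; lia.
have Akm : ((d + t).+1 * k + t <= m)%N.
  by have := leq_divM (m - t) (d + t).+1; rewrite -/k mulnC; lia.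
apply: le_trans (levin_constant R b1 s0 d0 hm (erefl K)) _; rewrite lerD2l.
apply: minmax_shifted_discr_ge => [|Q]; first exact: ltnW.
apply: (@max_shifted_discr_ge R b m s d t (d + t).+1 k x b1 _ _ _ _ k0 Akm) => //.
- by move=> n i j; apply: ltn_ord.
- by move=> n n' M g; apply: (box_empty psiK psiVK psi0 pm pI pinj yI aE).
- move=> N M S h g.
  exact: (@box_card _ _ _ _ _ _ _ psiK psiVK psi0 pm pI pinj yI aE m).
by rewrite /K mulnC leq_divM.
Qed.
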